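(* For $n\ge0$ let $P^{\mathrm{B}}_n(t)=\sum_{k=0}^{n}B(n,k)t^k$. For every $t\ge0$, $\int_{\mathbb{R}}x^n\,d\mu^{\mathrm{B}}_t(x)=P^{\mathrm{B}}_n(t)$ for all $n\ge0$, where $\mu^{\mathrm{B}}_t$ is the probability measure given by $\mu^{\mathrm{B}}_0=\delta_1$, \[\mu^{\mathrm{B}}_t=\sum_{k=0}^{\infty}(1-t)t^k\delta_{(2k+1)(1-t)}\quad\text{if }0<t<1,\] \[\mu^{\mathrm{B}}_1=\tfrac12 e^{-x/2}\chi_{[0,+\infty)}(x)\,dx,\] \[\mu^{\mathrm{B}}_t=\sum_{k=0}^{\infty}\frac{t-1}{t^{k+1}}\delta_{(2k+1)(t-1)}\quad\text{if }t>1.\] In particular $\{P^{\mathrm{B}}_n(t)\}_{n\ge0}$ is positive definite for $t\ge0$.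
   Context: $\mathcal{B}_n$ is the group of permutations $\sigma$ of $\{-n,\dots,-1,0,1,\dots,n\}$ with $\sigma(-k)=-\sigma(k)$ for all $k$ (so $\sigma(0)=0$). For $\sigma\in\mathcal{B}_n$, $\mathrm{desc}(\sigma)$ is the number of $i\in\{0,\dots,n-1\}$ with $\sigma(i)>\sigma(i+1)$, i.e. the number of descends of the sequence $(0,\sigma(1),\dots,\sigma(n))$. $B(n,k)=\#\{\sigma\in\mathcal{B}_n:\mathrm{desc}(\sigma)=k\}$ for $0\le k\le n$. $\delta_a$ is the Dirac measure at $a$. A real sequence $\{a_n\}$ is positive definite if $\sum_{i,j}a_{i+j}c_ic_j\ge0$ for all finitely supported real $\{c_i\}$. *)

(* Defs.v *)
From HB Require Import structures.
From mathcomp Require Import all_boot all_order all_algebra all_fingroup.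
From mathcomp Require Import all_classical all_reals all_analysis.

Set Implicit Arguments.
Unset Strict Implicit.
Unset Printing Implicit Defensive.

Import Order.TTheory GRing.Theory Num.Theory.
Import numFieldNormedType.Exports.

Local Open Scope classical_set_scope.
Local Open Scope ring_scope.

(* The index [i : 'I_(n.*2.+1)] stands for the integer [i - n], so these are
   the permutations of {-n, ..., n}; [rev_ord] is then negation, and the order
   of the indices is the order of the integers they stand for. *)
Definition signed_perm (n : nat) : {set {perm 'I_n.*2.+1}} :=
  [set s : {perm 'I_n.*2.+1} | [forall i, s (rev_ord i) == rev_ord (s i)]]%SET.

(* [sidx n k] stands for the integer [k], for [k <= n]. *)
Definition sidx (n k : nat) : 'I_n.*2.+1 := inord (n + k).

Definition descB (n : nat) (s : {perm 'I_n.*2.+1}) : nat :=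
  #|[set i : 'I_n | (s (sidx n i.+1) < s (sidx n i))%N]%SET|.

Definition eulerB (n k : nat) : nat :=
  #|[set s in signed_perm n | descB s == k]%SET|.

Definition PB (R : realType) (n : nat) (t : R) : R :=
  \sum_(k < n.+1) (eulerB n k)%:R * t ^+ k.

(* Meaningful for [0 <= t]; the last branch is then the case [1 < t]. *)
Definition muB (R : realType) (t : R) (A : set R) : \bar R :=
  (if t == 0%R then \d_(1%R : R) A
   else if (t < 1)%R then
     \sum_(0 <= k <oo) (((1 - t) * t ^+ k)%R%:E
                        * \d_((k.*2.+1%:R * (1 - t))%R : R) A)
   else if t == 1%R then
     \int[lebesgue_measure]_(x in A)
        (2^-1 * expR (- (x / 2)) * \1_(`[0%R, +oo[) x)%R%:E
   else
     \sum_(0 <= k <oo) (((t - 1) / t ^+ k.+1)%R%:E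
                        * \d_((k.*2.+1%:R * (t - 1))%R : R) A))%E.

Definition posdef_seq (R : realType) (a : nat -> R) : Prop :=
  forall c : nat -> R, finite_set [set i | c i != 0] ->
    0 <= \sum_(i \in [set: nat]) \sum_(j \in [set: nat]) a (i + j)%N * c i * c j.

(* Main.v *)
(* Removing the letter of largest absolute value from the word of a signed
   permutation, and counting the 2n ways to put it back according to the number
   of descents created, gives by induction the type B Worpitzky identity
     (2x+1)^n = sum_k B(n,k) C(x+n-k, n).
   Multiplying by t^x and summing over x with the negative binomial series,
     sum_x (2x+1)^n t^x = P_n(t) / (1-t)^(n+1)    (0 <= t < 1),
   which is the moment formula for t < 1; the palindromicity
   P_n(t) = t^n P_n(1/t) carries it over to t > 1, and at t = 1 both sides are
   2^n n!.  All these measures are carried by [0, +oo[, so moments and absolute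
   moments agree, and positive definiteness is the nonnegativity of the integral
   of (sum_i c_i x^i)^2. *)
Require Import Defs.
From HB Require Import structures.
From mathcomp Require Import all_boot all_order all_algebra all_fingroup.
From mathcomp Require Import all_classical all_reals all_analysis.
From mathcomp Require Import measurable_realfun exponential_distribution.
From mathcomp Require Import zify ring lra.

Set Implicit Arguments.
Unset Strict Implicit.
Unset Printing Implicit Defensive.

Import Order.TTheory GRing.Theory Num.Theory.
Import numFieldNormedType.Exports.

Local Open Scope classical_set_scope.
Local Open Scope ring_scope.

(** * Words of signed permutations *)

(** The argument [x] is the letter standing just before the word. Type B descents are those with
    [x = 0], the value at 0 of every signed permutation. *)
Fixpoint desc (x : int) (w : seq int) : nat :=
  if w is y :: w' then ((y < x)%R + desc y w')%N else 0%N.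

Lemma desc_size x w : (desc x w <= size w)%N.
Proof. elim: w x => //= y w IH x; have := IH y; case: (y < x); lia. Qed.

Lemma desc_sum x w : desc x w =
  (\sum_(i < size w) (nth 0 (x :: w) i.+1 < nth 0 (x :: w) i)%R)%N.
Proof. by elim: w x => [|y w IH] x /=; rewrite ?big_ord0 // big_ord_recl IH. Qed.

Definition ins (a : int) (i : nat) (w : seq int) : seq int :=
  take i w ++ a :: drop i w.

Lemma ins0 a w : ins a 0 w = a :: w.
Proof. by rewrite /ins take0 drop0. Qed.

(* A largest letter creates a descent unless it is inserted inside a descent or
   at the end; for a smallest letter the end also creates one. *)
Lemma sum_desc_ins_gt (f : nat -> nat) (x : int) w (a : int) :
  x < a -> all (< a) w ->
  (\sum_(i < (size w).+1) f (desc x (ins a i w)) =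
   (desc x w).+1 * f (desc x w) + (size w - desc x w) * f (desc x w).+1)%N.
Proof.
elim: w x f => [|y w IH] x f xa /=.
  by rewrite big_ord_recl big_ord0 /= ltNge (ltW xa) mul1n !addn0.
move=> /andP[ya wa]; rewrite big_ord_recl ins0 /= ya (ltNge a) (ltW xa) /=.
under eq_bigr => i _ do rewrite !add0n -/(ins a i w).
(* The induction runs over all [f], so that a possible descent from [x] to [y], untouched by
   insertions further right, is absorbed into [f]. *)
rewrite (IH y (fun d => f ((y < x)%R + d)%N)) //.
have := desc_size y w; case: (y < x) => /=; rewrite ?add0n ?add1n; nia.
Qed.

Lemma sum_desc_ins_lt (f : nat -> nat) (x : int) w (a : int) :
  a < x -> all (> a) w ->
  (\sum_(i < (size w).+1) f (desc x (ins a i w)) =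
   desc x w * f (desc x w) + (size w - desc x w).+1 * f (desc x w).+1)%N.
Proof.
elim: w x f => [|y w IH] x f xa /=.
  by rewrite big_ord_recl big_ord0 /= xa mul1n !addn0.
move=> /andP[ya wa]; rewrite big_ord_recl ins0 /= xa (ltNge y) (ltW ya) /=.
under eq_bigr => i _ do rewrite !add0n -/(ins a i w).
rewrite (IH y (fun d => f ((y < x)%R + d)%N)) //.
have := desc_size y w; case: (y < x) => /=; rewrite ?add0n ?add1n; nia.
Qed.

(** * One-line notations of signed permutations and their enumeration by insertion *)

Definition signed_word n (w : seq int) := perm_eq (map absz w) (iota 1 n).

(** The recursion mirrors the insertion of the letter of largest absolute value, with either sign,
    into one of the gaps of a shorter word, the two ends included; sums over words thus reduce to
    the insertion counts above. *)
Fixpoint signed_words n : seq (seq int) :=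
  if n is m.+1 then
    [seq ins p.1 p.2 w | w <- signed_words m,
       p <- [seq (a, i) | a <- [:: m.+1%:Z; - m.+1%:Z], i <- iota 0 m.+1]]
  else [:: [::]].

Lemma signed_wordsS n : signed_words n.+1 =
  [seq ins p.1 p.2 w | w <- signed_words n,
     p <- [seq (a, i) | a <- [:: n.+1%:Z; - n.+1%:Z], i <- iota 0 n.+1]].
Proof. by []. Qed.

Lemma signed_word_size n w : signed_word n w -> size w = n.
Proof. by move=> /perm_size; rewrite size_map size_iota. Qed.

Lemma signed_word_bound n w z : signed_word n w -> z \in w -> (`|z| <= n)%N.
Proof.
move=> /perm_mem h zw; have := h `|z|%N.
by rewrite map_f // mem_iota => /esym /andP[_]; rewrite add1n ltnS.
Qed.

Lemma perm_iota1S n : perm_eq (iota 1 n.+1) (n.+1 :: iota 1 n).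
Proof. by rewrite -(addn1 n) iotaD /= add1n addn1 perm_catC /=. Qed.

Lemma mem_signed_words n w : (w \in signed_words n) = signed_word n w.
Proof.
elim: n w => [|n IH] w.
  by rewrite /signed_word inE; case: w => //= a w; apply/esym/negP => /perm_size.
rewrite signed_wordsS; apply/idP/idP.
  move=> /allpairsP[[v p] [vL pL ->]].
  move: pL => /allpairsP[[a i] /= [aL _ ->]] /=.
  rewrite IH in vL.
  have aE : absz a = n.+1 by move: aL; rewrite !inE => /orP[] /eqP -> //; lia.
  rewrite /signed_word /ins map_cat /= -cat1s perm_catCA cat1s.
  rewrite -map_cat cat_take_drop aE.
  by rewrite (permPr (perm_iota1S n)) perm_cons.
move=> wS.
have : n.+1 \in map absz w by rewrite (perm_mem wS) mem_iota; lia.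
move=> /mapP[a aw aE].
have iw : (index a w < size w)%N by rewrite index_mem.
(* Deleting the letter of absolute value n+1 gives the shorter word from which [w] arises by
   insertion. *)
pose v := take (index a w) w ++ drop (index a w).+1 w.
have wE : w = ins a (index a w) v.
  have ts : size (take (index a w) w) = index a w by rewrite size_takel // ltnW.
  rewrite /ins /v take_size_cat // drop_size_cat //.
  by rewrite -[LHS](cat_take_drop (index a w)) (drop_nth 0) // nth_index.
have sw := signed_word_size wS.
have vL : v \in signed_words n.
  rewrite IH /signed_word -(perm_cons n.+1).
  rewrite -(permPr (perm_iota1S n)) -(permPr wS).
  rewrite [in X in perm_eq _ X]wE /ins map_cat /= -aE perm_sym -cat1s.
  by rewrite perm_catCA cat1s -map_cat cat_take_drop.
have aL : (a, index a w) \in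
    [seq (b, i) | b <- [:: n.+1%:Z; - n.+1%:Z], i <- iota 0 n.+1].
  apply: allpairs_f; last by rewrite mem_iota -sw.
  by rewrite !inE aE; case: (a) => k /=; rewrite ?NegzE eqxx ?orbT.
by rewrite wE; exact: (allpairs_f (fun w p => ins p.1 p.2 w) vL aL).
Qed.

(** The inserted letter is the only one of absolute value n+1: [find] recovers its position, [nth]
    its value, and filtering it out leaves the original word. *)
Lemma ins_inj n a b i j v w : (absz a = n.+1) -> (absz b = n.+1) ->
  signed_word n v -> signed_word n w -> (i <= n)%N -> (j <= n)%N ->
  ins a i v = ins b j w -> [/\ a = b, i = j & v = w].
Proof.
move=> aE bE vS wS i_le j_le.
pose big (z : int) := absz z == n.+1.
have nbig u : signed_word n u -> ~~ has big u.
  move=> uS; apply/hasPn => z zu; rewrite /big neq_ltn ltnS.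
  by rewrite (signed_word_bound uS zu).
have findE c k u : absz c = n.+1 -> signed_word n u -> (k <= n)%N ->
    find big (ins c k u) = k.
  move=> cE uS kn; have := nbig _ uS.
  rewrite -{1}(cat_take_drop k u) has_cat negb_or => /andP[ht _].
  rewrite /ins find_cat (negPf ht) /= /big cE eqxx addn0 size_takel //.
  by rewrite (signed_word_size uS).
have nthE c k u : signed_word n u -> (k <= n)%N -> nth 0 (ins c k u) k = c.
  move=> uS kn; rewrite /ins nth_cat size_takel ?ltnn ?subnn //.
  by rewrite (signed_word_size uS).
have filE c k u : absz c = n.+1 -> signed_word n u ->
    seq.filter (predC big) (ins c k u) = u.
  move=> cE uS; rewrite /ins filter_cat /= /big cE eqxx /=.
  rewrite -filter_cat cat_take_drop; apply/all_filterP.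
  by rewrite all_predC nbig.
move=> e.
have ij : i = j by rewrite -(findE a i v) // e findE.
split=> //; first by rewrite -(nthE a i v) // e ij nthE.
by rewrite -(filE a i v) // e filE.
Qed.

Lemma signed_words_uniq n : uniq (signed_words n).
Proof.
elim: n => // n IH; rewrite signed_wordsS.
apply: (@allpairs_uniq _ _ _ (fun w p => ins p.1 p.2 w)) => //.
  apply: allpairs_uniq; rewrite ?iota_uniq //=; last by case=> ? ? [].
move=> _ _ /allpairsP[[v p] [vL pL ->]] /allpairsP[[w q] [wL qL ->]].
have absE c : c \in [:: n.+1%:Z; - n.+1%:Z] -> absz c = n.+1.
  by rewrite !inE => /orP[] /eqP -> //; lia.
case/allpairsP: pL => -[a i] [/absE aE iL ->].
case/allpairsP: qL => -[b j] [/absE bE jL ->] /= e.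
rewrite !mem_signed_words in vL wL; rewrite !mem_iota in iL jL.
have [-> -> ->] // : [/\ a = b, i = j & v = w].
exact: (ins_inj aE bE vL wL iL jL e).
Qed.

Lemma size_signed_words n : size (signed_words n) = (2 ^ n * n`!)%N.
Proof.
elim: n => // n IH.
by rewrite signed_wordsS size_allpairs size_cat /= cats0 !size_map size_iota IH
  expnS factS; nia.
Qed.

(** * Recurrence on the number of descents and Worpitzky identity for words *)

Lemma sum_signed_wordsS n (f : nat -> nat) :
  (\sum_(w <- signed_words n.+1) f (desc 0 w) =
   \sum_(w <- signed_words n)
     ((desc 0 w).*2.+1 * f (desc 0 w) + (n - desc 0 w).*2.+1 * f (desc 0 w).+1))%N.
Proof.
rewrite signed_wordsS big_allpairs_dep big_seq [RHS]big_seq; apply: eq_bigr => w.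
rewrite mem_signed_words => wS.
have ws := signed_word_size wS; have wb z := @signed_word_bound _ _ z wS.
rewrite big_allpairs_dep.
transitivity (\sum_(a <- [:: n.+1%:Z; - n.+1%:Z])
    \sum_(i < n.+1) f (desc 0 (ins a i w)))%N.
  by apply: eq_bigr => a _; rewrite -[iota 0 n.+1]/(index_iota 0 n.+1) big_mkord.
(* The letter n+1 exceeds 0 and all of [w], and -(n+1) is below them. With d descents in [w], the
   two signs give (d+1)+d insertions keeping d and (n-d)+(n-d+1) insertions raising it by one. *)
rewrite !big_cons big_nil /= addn0 -ws sum_desc_ins_gt ?sum_desc_ins_lt //;
  try by [lia | apply/allP => z /wb /=; lia].
have := desc_size 0 w; rewrite ws; nia.
Qed.

(** Put m = x+n-d. Pascal's rule turns the left side into (2d+1)C(m,n) + (2n+2)C(m,n+1), and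
    (n+1)C(m,n+1) = (m-n)C(m,n) with m-n = x-d. For m < n every binomial coefficient vanishes. *)
Lemma bin_desc_identity n d x : (d <= n)%N ->
  (d.*2.+1 * 'C(x + n.+1 - d, n.+1) + (n - d).*2.+1 * 'C(x + n.+1 - d.+1, n.+1)
   = x.*2.+1 * 'C(x + n - d, n))%N.
Proof.
move=> dn; rewrite addnS subSS subSn; last by lia.
rewrite binS; set m := (x + n - d)%N.
have := mul_bin_left m n; case: (leqP n m) => mn; rewrite /m in mn *; first by nia.
by rewrite !bin_small ?muln0 //; lia.
Qed.

Lemma worpitzkyB_words n x :
  (\sum_(w <- signed_words n) 'C(x + n - desc 0 w, n) = x.*2.+1 ^ n)%N.
Proof.
elim: n => [|n IH]; first by rewrite big_seq1 bin0.
rewrite (sum_signed_wordsS _ (fun d => 'C(x + n.+1 - d, n.+1))) expnS -IH big_distrr /=.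
rewrite big_seq [RHS]big_seq; apply: eq_bigr => w.
rewrite mem_signed_words => /signed_word_size sw.
by rewrite bin_desc_identity // -sw desc_size.
Qed.

(** * Bijection between signed permutations and signed words *)

Definition word_of n (s : {perm 'I_n.*2.+1}) : seq int :=
  [seq (s (sidx n i.+1))%:Z - n%:Z | i <- iota 0 n].

Lemma sidxE n k : (k <= n)%N -> sidx n k = (n + k)%N :> nat.
Proof. by move=> kn; rewrite inordK //; lia. Qed.

Lemma signed_permP n (s : {perm 'I_n.*2.+1}) :
  reflect (forall i, s (rev_ord i) = rev_ord (s i)) (s \in signed_perm n).
Proof. by rewrite inE; apply: (iffP forallP) => h i; apply/eqP. Qed.

(** The index of 0 is the only fixed point of [rev_ord], and [s] commutes with [rev_ord]. *)
Lemma signed_perm0 n (s : {perm 'I_n.*2.+1}) :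
  s \in signed_perm n -> s (sidx n 0) = sidx n 0.
Proof.
move=> /signed_permP /(_ (sidx n 0)).
have -> : rev_ord (sidx n 0) = sidx n 0.
  by apply: val_inj; rewrite /= sidxE; lia.
move=> /(congr1 val) /= e; apply: val_inj => /=; rewrite sidxE //.
by have := ltn_ord (s (sidx n 0)); lia.
Qed.

Lemma nth_word_of n (s : {perm 'I_n.*2.+1}) i : s \in signed_perm n ->
  (i <= n)%N -> nth 0 (0 :: word_of s) i = (s (sidx n i))%:Z - n%:Z.
Proof.
move=> sS; case: i => [|i] ni /=; first by rewrite signed_perm0 // sidxE //; lia.
by rewrite (nth_map 0%N) ?size_iota // nth_iota.
Qed.

Lemma descB_word n (s : {perm 'I_n.*2.+1}) : s \in signed_perm n ->
  descB s = desc 0 (word_of s).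
Proof.
move=> sS; rewrite desc_sum size_map size_iota /descB -sum1dep_card big_mkcond /=.
apply: eq_bigr => i _; rewrite -[_`_i]/(nth 0 (0 :: word_of s) i.+1).
rewrite !nth_word_of //; last by rewrite ltnW.
by rewrite ltrD2r ltz_nat; case: ifP.
Qed.

(** If the values at a, b >= 0 have equal absolute value, then s(a) = s(b) or s(a) = s(-b), so a =
    b. The letters thus have n distinct absolute values; comparison with position 0 shows that they
    are nonzero, so they fill 1, ..., n. *)
Lemma signed_word_word_of n (s : {perm 'I_n.*2.+1}) :
  s \in signed_perm n -> signed_word n (word_of s).
Proof.
move=> sS; have s0 := signed_perm0 sS; have sr := signed_permP _ sS.
have val_inj_s a b : (a <= n)%N -> (b <= n)%N ->
    absz ((s (sidx n a))%:Z - n%:Z) = absz ((s (sidx n b))%:Z - n%:Z) -> a = b.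
  move=> an bn e; have := ltn_ord (s (sidx n a)); have := ltn_ord (s (sidx n b)).
  move=> lta ltb.
  have [] : (s (sidx n a) = s (sidx n b) :> nat) \/
      (s (sidx n a) = rev_ord (s (sidx n b)) :> nat) by rewrite /=; lia.
    by move=> /val_inj/perm_inj/(congr1 val) /=; rewrite !sidxE //; lia.
  by rewrite -sr => /val_inj/perm_inj/(congr1 val) /=; rewrite !sidxE //; lia.
rewrite /signed_word /word_of -map_comp; set v := map _ _.
have vu : uniq v.
  rewrite map_inj_in_uniq ?iota_uniq // => a b.
  by rewrite !mem_iota => ha hb /= /val_inj_s h; have := h ltac:(lia) ltac:(lia); lia.
have vs : {subset v <= iota 1 n}.
  move=> _ /mapP[a + ->]; rewrite !mem_iota /= => ha.
  have := ltn_ord (s (sidx n a.+1)); have := val_inj_s a.+1 0%N ltac:(lia) ltac:(lia).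
  rewrite s0 sidxE // addn0 subrr => h lt.
  have : absz ((s (sidx n a.+1))%:Z - n%:Z) <> 0%N by move=> /h.
  by move: (nat_of_ord _) lt => y lt ne; clear -lt ne; lia.
have [|_ vE] := uniq_min_size vu vs; first by rewrite size_map !size_iota.
by apply: uniq_perm => //; exact: iota_uniq.
Qed.

Lemma word_of_inj n : {in signed_perm n &, injective (@word_of n)}.
Proof.
move=> s u sS uS e; have := signed_permP _ uS; have := signed_permP _ sS => sr ur.
have pos i : (i <= n)%N -> s (sidx n i) = u (sidx n i).
  move=> ni; apply: val_inj => /=.
  by have := nth_word_of sS ni; rewrite e nth_word_of //; lia.
apply/permP => i; case: (leqP n i) => ni.
  have -> : i = sidx n (i - n).
    by apply: val_inj; rewrite /= sidxE; have := ltn_ord i; lia.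
  by apply: pos; have := ltn_ord i; lia.
apply: rev_ord_inj; rewrite -sr -ur.
have -> : rev_ord i = sidx n (n - i).
  by apply: val_inj; rewrite /= sidxE; have := ltn_ord i; lia.
by apply: pos; lia.
Qed.

Lemma word_of_surj n w : signed_word n w ->
  exists2 s, s \in signed_perm n & word_of s = w.
Proof.
move=> wS; have sw := signed_word_size wS.
have wb k : (absz (nth 0%R (0%R :: w) k) <= n)%N.
  case: k => //= k; case: (ltnP k (size w)) => kw.
    by apply: signed_word_bound wS (mem_nth _ kw).
  by rewrite nth_default.
have w_inj a b : (a <= n)%N -> (b <= n)%N ->
    absz (nth 0 (0 :: w) a) = absz (nth 0 (0 :: w) b) -> a = b.
  move=> an bn; rewrite -!(nth_map _ 0%N absz) /= ?sw //.
  move/eqP; rewrite nth_uniq /= ?size_map ?sw // => [/eqP //|].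
  by rewrite (perm_mem wS) (perm_uniq wS) iota_uniq mem_iota.
(* The odd extension of the word to {-n, ..., n}, with value 0 at 0; [f] is the same map on
   indices. *)
pose g (i : 'I_n.*2.+1) : int := if (n <= i)%N then nth 0 (0 :: w) (i - n)
  else - nth 0 (0 :: w) (n - i).
have gb i : (absz (g i) <= n)%N by rewrite /g; case: ifP; rewrite ?abszN wb.
pose f i : 'I_n.*2.+1 := inord (absz (n%:Z + g i)).
have fE i : (f i)%:Z = n%:Z + g i :> int by rewrite /f inordK; have := gb i; lia.
have gr i : g (rev_ord i) = - g i.
  rewrite /g /=; have := ltn_ord i; case: (ltngtP n i) => ni li.
  - by rewrite leqNgt (_ : (_ < _)%N) /=; [congr (- nth _ _ _); lia | lia].
  - by rewrite (_ : (_ <= _)%N) ?opprK; [congr (nth _ _ _); lia | lia].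
  - by rewrite -ni (_ : (n.*2.+1 - n.+1 = n)%N) ?leqnn ?subnn ?oppr0 //; lia.
have f_inj : injective f.
  move=> i j /(congr1 (fun k : 'I__ => (k : nat)%:Z)); rewrite !fE => /addrI e.
  apply: val_inj => /=; move: (e) (congr1 absz e); rewrite /g.
  have li := ltn_ord i; have lj := ltn_ord j.
  case: (leqP n i) => ni; case: (leqP n j) => nj; rewrite ?abszN => {}e /w_inj h.
  - have := h ltac:(lia) ltac:(lia); lia.
  (* With arguments on opposite sides of 0, equal values force a letter of [0 :: w] to equal its own
     negative. That letter is 0, hence sits at position 0, against the strict inequality on one of
     the arguments. *)
  - have hh := h ltac:(lia) ltac:(lia).
    rewrite hh in e; have /(congr1 absz) e0 : nth 0 (0 :: w) (n - j) = 0 by lia.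
    by have := w_inj (n - j)%N 0%N ltac:(lia) ltac:(lia) e0; lia.
  - have hh := h ltac:(lia) ltac:(lia).
    rewrite hh in e; have /(congr1 absz) e0 : nth 0 (0 :: w) (j - n) = 0 by lia.
    by have := w_inj (j - n)%N 0%N ltac:(lia) ltac:(lia) e0; lia.
  - have := h ltac:(lia) ltac:(lia); lia.
exists (perm f_inj).
  apply/signed_permP => i; rewrite !permE; apply: val_inj => /=.
  have := fE i; have := fE (rev_ord i); rewrite gr; have := ltn_ord (f i); lia.
apply: (@eq_from_nth _ 0); rewrite size_map size_iota ?sw // => i ni.
rewrite (nth_map 0%N) ?size_iota // nth_iota // permE fE addrC addKr /g.
by rewrite sidxE ?leq_addr //  addKn.
Qed.

Lemma perm_word_of n :
  perm_eq [seq word_of s | s <- enum (signed_perm n)] (signed_words n).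
Proof.
apply: uniq_perm; rewrite ?signed_words_uniq //.
  rewrite map_inj_in_uniq ?enum_uniq // => s u; rewrite !mem_enum.
  exact: word_of_inj.
move=> w; rewrite mem_signed_words; apply/mapP/idP => [[s]|/word_of_surj[s sS <-]].
  by rewrite mem_enum => sS ->; exact: signed_word_word_of.
by exists s; rewrite ?mem_enum.
Qed.

(** * Type B Eulerian numbers *)

Lemma descB_le n (s : {perm 'I_n.*2.+1}) : (descB s <= n)%N.
Proof. by rewrite -[X in (_ <= X)%N](card_ord n) max_card. Qed.

(** Binomial coefficients for [f] give the Worpitzky identity, and the constant 1 gives the order of
    the group. *)
Lemma sum_eulerB n (f : nat -> nat) :
  (\sum_(k < n.+1) eulerB n k * f k = \sum_(w <- signed_words n) f (desc 0 w))%N.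
Proof.
rewrite -(perm_big _ (perm_word_of n)) big_map big_enum /=.
under [RHS]eq_bigr => s sS do rewrite -descB_word //.
rewrite (partition_big (fun s => inord (descB s) : 'I_n.+1) xpredT) //=.
apply: eq_bigr => k _; rewrite /eulerB -sum1dep_card big_distrl /=.
apply: eq_big => [s|s /andP[_ /eqP ->]]; last by rewrite mul1n.
by rewrite -val_eqE /= inordK // ltnS descB_le.
Qed.

Lemma worpitzkyB n x :
  (\sum_(k < n.+1) eulerB n k * 'C(x + n - k, n) = x.*2.+1 ^ n)%N.
Proof. by rewrite (sum_eulerB n (fun k => 'C(x + n - k, n))) worpitzkyB_words. Qed.

Lemma sum_eulerB1 n : (\sum_(k < n.+1) eulerB n k = 2 ^ n * n`!)%N.
Proof.
rewrite -size_signed_words -sum1_size -(sum_eulerB _ (fun=> 1%N)).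
by under [RHS]eq_bigr do rewrite muln1.
Qed.

(** In the Worpitzky identity at x = 0 only the term k = 0 survives, since C(n-k,n) = 0 for k >
    0. *)
Lemma eulerB0 n : eulerB n 0 = 1%N.
Proof.
have := worpitzkyB n 0; rewrite big_ord_recl big1 ?addn0 => [|i _].
  by rewrite add0n subn0 binn muln1 exp1n.
by rewrite bin_small ?muln0 // lift0; have := ltn_ord i; lia.
Qed.

(** The map sending s to -s (composition with [r]) is a bijection of the group that exchanges
    descents and ascents among the n adjacent pairs. *)
Lemma eulerB_sym n k : (k <= n)%N -> eulerB n (n - k) = eulerB n k.
Proof.
move=> kn; pose r := perm (@rev_ord_inj n.*2.+1).
have rE (s : {perm 'I_n.*2.+1}) i : (s * r)%g i = rev_ord (s i).
  by rewrite permM permE.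
have rS (s : {perm 'I_n.*2.+1}) :
    ((s * r)%g \in signed_perm n) = (s \in signed_perm n).
  apply/signed_permP/signed_permP => h i; have := h i; rewrite !rE;
    [exact: rev_ord_inj | by move=> ->].
have rD (s : {perm 'I_n.*2.+1}) : (descB (s * r)%g + descB s = n)%N.
  rewrite -[RHS](card_ord n).
  rewrite -(cardsC [set i : 'I_n | (s (sidx n i.+1) < s (sidx n i))%N]%SET).
  rewrite addnC /descB; congr (_ + _)%N; apply: eq_card => i.
  rewrite !inE !rE /= -leqNgt.
  have : s (sidx n i.+1) != s (sidx n i) :> nat.
    apply/negP => /eqP/val_inj/perm_inj/(congr1 val); rewrite /= !sidxE //; first by lia.
    exact: ltnW.
  have := ltn_ord (s (sidx n i)); have := ltn_ord (s (sidx n i.+1)); lia.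
have inK m (u : {perm 'I_n.*2.+1}) :
    (u \in [set s in signed_perm n | descB s == m]%SET) =
    (u \in signed_perm n) && (descB u == m) by rewrite finset.in_set.
rewrite /eulerB -[RHS](card_imset _ (mulIg r)); apply: eq_card => s.
apply/idP/imsetP => [|[u]].
  rewrite inK => /andP[sS /eqP sk].
  exists (s * r^-1)%g; last by rewrite mulgKV.
  have := rD (s * r^-1)%g; rewrite mulgKV => ?.
  by rewrite inK -rS mulgKV sS; lia.
rewrite inK => /andP[uS /eqP uk] ->; rewrite inK rS uS.
by rewrite -[X in (X - k)%N](rD u) uk addnK /= eqxx.
Qed.

(** * Generating series *)

Lemma PB0 (R : realType) n : PB n (0 : R) = 1.
Proof.
rewrite /PB big_ord_recl big1 ?addr0 => [|i _].
  by rewrite eulerB0 expr0 mulr1.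
by rewrite lift0 expr0n mulr0.
Qed.

Lemma PB0n (R : realType) (t : R) : PB 0 t = 1.
Proof. by rewrite /PB big_ord_recl big_ord0 eulerB0 expr0 mulr1 addr0. Qed.

Lemma PB1 (R : realType) n : PB n (1 : R) = (2 ^ n * n`!)%:R.
Proof.
rewrite -sum_eulerB1 natr_sum /PB.
by under [LHS]eq_bigr do rewrite expr1n mulr1.
Qed.

Lemma PB_palindromic (R : realType) n (t : R) : t != 0 ->
  t ^+ n * PB n t^-1 = PB n t.
Proof.
move=> t0; rewrite /PB big_distrr /= (reindex_inj rev_ord_inj) /=.
apply: eq_bigr => i _; have ni : (i <= n)%N by rewrite -ltnS.
rewrite subSS eulerB_sym // mulrCA exprVn; congr (_ * _).
by rewrite -[in t ^+ n](subnK ni) exprD mulrC mulKf // expf_neq0.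
Qed.

(** By Pascal's rule, multiplication by 1-t lowers the order of the negative binomial series by one;
    the last term is the boundary term of the truncation at N. *)
Lemma negbin_partial_sum (R : realType) (t : R) r N :
  (1 - t) * series (fun m => 'C(m + r.+1, r.+1)%:R * t ^+ m) N =
  series (fun m => 'C(m + r, r)%:R * t ^+ m) N - 'C(N + r, r.+1)%:R * t ^+ N.
Proof.
rewrite /series /=; elim: N => [|N IH].
  by rewrite !big_geq // mulr0 bin_small // mul0r subr0.
rewrite !big_nat_recr //= mulrDr IH addSn addnS !binS !natrD exprS.
ring.
Qed.

Lemma cvg_negbin_series (R : realType) (t : R) r : 0 <= t -> t < 1 ->
  series (fun m => 'C(m + r, r)%:R * t ^+ m) @ \oo --> ((1 - t) ^- r.+1).
Proof.
move=> t0 t1; have t1' : 0 < 1 - t by lra.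
have t1n : 1 - t != 0 by rewrite gt_eqF.
elim: r => [|r IH].
  rewrite (_ : (fun m => _) = geometric 1 t).
    by rewrite expr1 -[X in _ --> X]mul1r; apply: cvg_geometric_series; rewrite ger0_norm.
  by apply/funext => m; rewrite bin0.
set u := fun m => 'C(m + r, r)%:R * t ^+ m in IH *.
pose v m := 'C(m + r.+1, r.+1)%:R * t ^+ m.
have v0 m : 0 <= v m by rewrite mulr_ge0 // exprn_ge0.
have u0 m : 0 <= u m by rewrite mulr_ge0 // exprn_ge0.
have vE N : series v N = (1 - t)^-1 * (series u N - 'C(N + r, r.+1)%:R * t ^+ N).
  by rewrite -negbin_partial_sum mulKf.
(* The boundary term is nonnegative, so the partial sums of [v] are bounded by the limit known for
   [u], divided by 1-t. *)
have vcvg : cvgn (series v).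
  apply: nondecreasing_is_cvgn; first exact: nondecreasing_series.
  exists ((1 - t)^-1 * limn (series u)) => _ [N _ <-].
  rewrite vE; apply: ler_wpM2l; first by rewrite invr_ge0 ltW.
  apply: (@le_trans _ _ (series u N)).
    by rewrite lerBlDr lerDl mulr_ge0 // exprn_ge0.
  apply: nondecreasing_cvgn_le; last exact: cvgP IH.
  exact: nondecreasing_series.
have v_0 := cvg_series_cvg_0 vcvg.
rewrite -[X in X @ _]/(series v) -cvg_shiftS /=.
(* After a shift by one the boundary term is [t * v N], which tends to 0 because [series v]
   converges. *)
rewrite (_ : (fun n => series v n.+1) =
   (fun N => (1 - t)^-1 * (series u N.+1 - t * v N))); last first.
  by apply/funext => N; rewrite vE /v addSn -addnS exprS; congr (_ * (_ - _)); ring.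
have -> : (1 - t) ^- r.+2 = (1 - t)^-1 * ((1 - t) ^- r.+1 - t * 0).
  by rewrite mulr0 subr0 exprS invfM.
apply: cvgM; first exact: cvg_cst.
apply: cvgB; first by rewrite cvg_shiftS.
by apply: cvgM => //; exact: cvg_cst.
Qed.

(** The terms with x < k vanish; re-indexing the others by x = m+k pulls out the factor t^k. *)
Lemma cvg_shifted_negbin_series (R : realType) (t : R) n k :
  0 <= t -> t < 1 -> (k <= n)%N ->
  series (fun x => 'C(x + n - k, n)%:R * t ^+ x) @ \oo -->
    (t ^+ k * (1 - t) ^- n.+1).
Proof.
move=> t0 t1 kn; rewrite -(cvg_shiftn k) /=.
rewrite (_ : (fun N => _) =
    (fun N => t ^+ k * series (fun m => 'C(m + n, n)%:R * t ^+ m) N)).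
  by apply: cvgM; [exact: cvg_cst | exact: cvg_negbin_series].
apply/funext => N; rewrite /series /= (@big_cat_nat _ _ _ k) ?leq_addl //=.
rewrite big_nat big1 ?add0r => [|i /andP[_ ik]]; last first.
  by rewrite bin_small ?mul0r //; lia.
rewrite -{1}(add0n k) big_addn addnK big_distrr /=; apply: eq_bigr => i _.
rewrite (_ : i + k + n - k = i + n)%N; last by lia.
by rewrite exprD; ring.
Qed.

Lemma cvg_PB_series (R : realType) (t : R) n : 0 <= t -> t < 1 ->
  series (fun x => x.*2.+1%:R ^+ n * t ^+ x) @ \oo --> (PB n t * (1 - t) ^- n.+1).
Proof.
move=> t0 t1.
rewrite (_ : series _ = (fun N => \sum_(k < n.+1)
    (eulerB n k)%:R * series (fun x => 'C(x + n - k, n)%:R * t ^+ x) N)).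
  rewrite /PB big_distrl /=; apply: cvg_big => [|k _].
    exact: add_continuous.
  rewrite -mulrA; apply: cvgM; first exact: cvg_cst.
  apply: cvg_shifted_negbin_series => //.
  by rewrite -ltnS.
apply/funext => N; rewrite /series /=.
under [RHS]eq_bigr do rewrite big_distrr /=.
rewrite exchange_big /=; apply: eq_bigr => x _.
rewrite -natrX -worpitzkyB natr_sum big_distrl /=.
by apply: eq_bigr => k _; rewrite natrM mulrA.
Qed.

(** * Measures with prescribed moments *)

Section unit_mass.
Context d (T : measurableType d) (R : realType).
Variable mu : {measure set T -> \bar R}.

(** An alias of [mu] indexed by the proof of total mass 1, so that the probability structure
    declared below can rest on that proof. *)
Definition unit_mass (_ : mu setT = 1%E) : set T -> \bar R := mu.

Hypothesis mu1 : mu setT = 1%E.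

HB.instance Definition _ := Measure.copy (unit_mass mu1) mu.
HB.instance Definition _ :=
  @Measure_isProbability.Build d T R (unit_mass mu1) mu1.

Lemma probability_of_measure :
  exists P : probability T R, (P : set T -> \bar R) = mu.
Proof. by exists (unit_mass mu1). Qed.

End unit_mass.

(** The Radon-Nikodym derivative of [nu] has the same integral as [g] over every measurable set, so
    the two agree almost everywhere, and change of variables for the derivative carries over to
    [g]. *)
Lemma ge0_integral_density d (T : measurableType d) (R : realType)
    (mu : {sigma_finite_measure set T -> \bar R})
    (nu : {finite_measure set T -> \bar R}) (g f : T -> \bar R) :
  measurable_fun setT g -> (forall x, 0 <= g x)%E ->
  (forall A, measurable A -> nu A = \int[mu]_(x in A) g x)%E ->
  (forall x, 0 <= f x)%E -> measurable_fun setT f ->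
  (\int[nu]_x f x = \int[mu]_x (f x * g x))%E.
Proof.
move=> mg g0 nuE f0 mf.
have numu : nu `<< mu.
  apply/null_content_dominatesP => A mA muA0; rewrite nuE //.
  by apply: null_set_integral => //; exact: measurable_funTS.
have hi := Radon_Nikodym_SigmaFinite.f_integrable numu.
rewrite -(Radon_Nikodym_SigmaFinite.change_of_variables numu f0 measurableT mf).
apply: ge0_ae_eq_integral => //.
- by apply: emeasurable_funM => //; exact: measurable_int hi.
- exact: emeasurable_funM.
- by move=> x _; rewrite mule_ge0 // Radon_Nikodym_SigmaFinite.f_ge0.
- by move=> x _; rewrite mule_ge0.
- apply: ae_eqe_mul2l; apply: integral_ae_eq => // E _ mE.
  by rewrite -nuE // -Radon_Nikodym_SigmaFinite.f_integral.
Qed.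

(** * Discrete measures with atoms at nonnegative points *)

Section discrete_probability.
Context (R : realType) (w p : nat -> R) (a : nat -> R).
Hypothesis w_ge0 : forall k, 0 <= w k.
Hypothesis p_ge0 : forall k, 0 <= p k.
Hypothesis moments : forall n, series (fun k => w k * p k ^+ n) @ \oo --> a n.

Let T := measurableTypeR R.

Definition atoms (k : nat) : {measure set T -> \bar R} :=
  mscale (NngNum (w_ge0 k)) (dirac (p k : T)).

Lemma integral_atoms (f : T -> \bar R) :
  measurable_fun setT f -> (forall x, 0 <= f x)%E ->
  (\int[mseries atoms 0]_x f x = \sum_(0 <= k <oo) (w k)%:E * f (p k))%E.
Proof.
move=> mf f0; rewrite ge0_integral_measure_series //.
apply: eq_eseriesr => k _; rewrite ge0_integral_mscale // integral_dirac //.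
by rewrite diracT mul1e.
Qed.

(** The condition [a 0 = 1] says that the total mass, the moment of order 0, is 1. As the atoms are
    nonnegative, the absolute moments are the given series. *)
Lemma discrete_probability : a 0 = 1 ->
  exists mu : probability T R,
    [/\ forall A, mu A = (\sum_(0 <= k <oo) (w k)%:E * \d_(p k) A)%E,
        mu [set x | x < 0] = 0%E &
        forall n, (\int[mu]_x (`|x| ^+ n)%:E = (a n)%:E)%E].
Proof.
move=> a0.
have limE n : (\sum_(0 <= k <oo) (w k * p k ^+ n)%:E = (a n)%:E)%E.
  apply/cvg_lim => //; under eq_fun do rewrite sumEFin.
  by apply: cvg_EFin; [exact: nearW | exact: moments].
have [|mu muE] := @probability_of_measure _ _ _ (mseries atoms 0).
  rewrite -[LHS]/(\sum_(0 <= k <oo) (w k)%:E * \d_(p k) setT)%E.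
  rewrite -a0 -limE; apply: eq_eseriesr => k _.
  by rewrite diracT mule1 expr0 mulr1.
exists mu; rewrite muE; split => [//||n].
  rewrite -[LHS]/(\sum_(0 <= k <oo) (w k)%:E * \d_(p k) [set x : R | (x < 0)%R])%E.
  apply: eseries0 => k _ _; rewrite diracE memNset ?mule0 //=.
  by apply/negP; rewrite -leNgt.
rewrite integral_atoms; last 2 first.
- by apply/measurable_EFinP; apply: measurable_funX.
- by move=> x; rewrite lee_fin exprn_ge0.
rewrite -limE; apply: eq_eseriesr => k _.
by rewrite ger0_norm // EFinM.
Qed.

End discrete_probability.

(** * The exponential law of rate 1/2 *)

Section exponential_moments.
Context (R : realType).

(** The antiderivative of x^n e^(-x/2)/2 produced by repeated integration by parts. *)
Fixpoint exp_antideriv (n : nat) (x : R) : R :=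
  if n is m.+1 then - (x ^+ n * expR (- (x / 2))) + (n.*2)%:R * exp_antideriv m x
  else - expR (- (x / 2)).

Let is_derive_exp_half (x : R) :
  is_derive x 1 (fun y : R => expR (- (y / 2))) (- 2^-1 * expR (- (x / 2))).
Proof.
rewrite (_ : (fun y => _) = expR \o (fun y => - 2^-1 *: y)); last first.
  by apply/funext => y /=; congr expR; rewrite /GRing.scale /=; ring.
have h : is_derive x 1 (fun y : R => - 2^-1 *: y) (- 2^-1 *: 1).
  exact: is_deriveZ.
apply: is_derive_eq (@is_derive1_comp _ expR _ x _ _ _ h) _.
by rewrite /GRing.scale /= mulr1 [LHS]mulrC [X in expR X]mulNr
  [X in expR (- X)]mulrC.
Qed.

Lemma is_derive_exp_antideriv n (x : R) :
  is_derive x 1 (exp_antideriv n) (x ^+ n * (2^-1 * expR (- (x / 2)))).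
Proof.
elim: n => [|n IH].
  apply: is_derive_eq (is_deriveN (is_derive_exp_half x)) _.
  by rewrite expr0 mul1r mulNr opprK.
have hX : is_derive x 1 (fun y : R => y ^+ n.+1) (n.+1%:R * x ^+ n).
  apply: DeriveDef; first exact: exprn_derivable.
  by rewrite exp_derive /GRing.scale /= mulr1.
have hM := is_deriveM hX (is_derive_exp_half x).
apply: is_derive_eq (is_deriveD (is_deriveN hM) (is_deriveZ _ IH)) _.
rewrite /GRing.scale /= exprS -mul2n natrM.
by field.
Qed.

Lemma exp_antideriv0 n : exp_antideriv n 0 = - (2 ^ n * n`!)%:R.
Proof.
elim: n => [|n IH] /=; first by rewrite mul0r oppr0 expR0.
rewrite exprS !mul0r oppr0 add0r IH mulrN -natrM; congr (- _%:R).
by rewrite expnS factS; lia.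
Qed.

Lemma cvg_exprM_expRN_half n :
  (x ^+ n * expR (- (x / 2))) @[x --> +oo] --> (0 : R).
Proof.
(* From e^(x/2) >= (x/2)^(n+1)/(n+1)! one gets x^n e^(-x/2) <= C/x with this constant. *)
pose C : R := (2 ^ n.+1 * n.+1`!)%:R.
apply: (@squeeze_cvgr _ _ _ _ (fun=> 0) (fun x => C * x^-1)).
- near=> x; have x0 : 0 < x by near: x; exact: nbhs_pinfty_gt.
  rewrite mulr_ge0 ?exprn_ge0 ?expR_ge0 ?(ltW x0) //=.
  rewrite expRN ler_pdivrMr ?expR_gt0 // mulrAC ler_pdivlMr // -exprSr.
  have := @expR_ge1Dxn R (x / 2) n; rewrite divr_ge0 ?(ltW x0) // => /(_ isT) h.
  have Cgt0 : 0 < C by rewrite ltr0n muln_gt0 expn_gt0 fact_gt0.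
  rewrite [leRHS]mulrC -ler_pdivrMr // (le_trans _ h) // ler_wpDl //.
  by rewrite /C natrM natrX expr_div_n invfM mulrA.
- exact: cvg_cst.
- rewrite -[X in _ --> X](mulr0 C); apply: cvgM; first exact: cvg_cst.
  by apply/gtr0_cvgV0 => //; near=> x; near: x; exact: nbhs_pinfty_gt.
Unshelve. all: by end_near. Qed.

Lemma cvg_exp_antideriv n : exp_antideriv n x @[x --> +oo] --> (0 : R).
Proof.
elim: n => [|n IH] /=.
  rewrite -oppr0; apply: cvgN; have := @cvg_exprM_expRN_half 0.
  by under eq_fun do rewrite expr0 mul1r.
rewrite [X in _ --> X](_ : 0 = - 0 + (n.+1.*2)%:R * 0); last first.
  by rewrite oppr0 mulr0 addr0.
apply: cvgD; first by apply: cvgN; exact: cvg_exprM_expRN_half.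
by apply: cvgM => //; exact: cvg_cst.
Qed.

Lemma exponential_half_moment n :
  (\int[lebesgue_measure]_(x in `[0%R, +oo[)
     (x ^+ n * (2^-1 * expR (- (x / 2))))%:E = (2 ^ n * n`!)%:R%:E :> \bar R)%E.
Proof.
have dF x : derivable (exp_antideriv n) x 1.
  by have [] := is_derive_exp_antideriv n x.
(* The final argument 0 is the limit of the antiderivative at infinity, so the integral is minus its
   value at 0. *)
rewrite (@ge0_continuous_FTC2y _ _ (exp_antideriv n) _ 0).
- by rewrite exp_antideriv0 EFinN oppeK add0e.
- by move=> x x0; rewrite mulr_ge0 ?exprn_ge0 // mulr_ge0 ?invr_ge0 ?expR_ge0.
- apply: derivable_within_continuous => x _.
  have hX : derivable (fun y : R => y ^+ n) x 1 by exact: exprn_derivable.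
  by apply: derivableM => //; exact: derivableM.
- exact: cvg_exp_antideriv.
- by move=> x _.
- apply: cvg_at_right_filter; apply: differentiable_continuous.
  exact/derivable1_diffP.
- by move=> x _; rewrite derive1E; have [] := is_derive_exp_antideriv n x.
Qed.

Lemma exponential_probability :
  exists mu : probability (measurableTypeR R) R,
    [/\ forall A, mu A = muB 1 A,
        mu [set x | x < 0] = 0%E &
        forall n, (\int[mu]_x (`|x| ^+ n)%:E = (2 ^ n * n`!)%:R%:E)%E].
Proof.
pose g := exponential_pdf (2^-1 : R).
have half_gt0 : 0 < 2^-1 :> R by rewrite invr_gt0.
have gE x : g x = 2^-1 * expR (- (x / 2)) * \1_(`[0%R, +oo[) x.
  rewrite /g /exponential_pdf patchE indicE; case: ifP => _; rewrite ?mulr0 // mulr1.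
  by congr (_ * expR _); rewrite mulNr mulrC.
have [mu muE] : exists P : probability (measurableTypeR R) R,
    (P : set _ -> \bar R) = exponential_prob 2^-1.
  unshelve (refine (ex_intro _ (exponential_prob (2^-1 : R) :
    probability (measurableTypeR R) R) _)) => //.
exists mu; split.
- move=> A; rewrite muE /muB oner_eq0 ltxx eqxx /exponential_prob.
  by apply: eq_integral => x _; rewrite -gE.
- rewrite muE /exponential_prob; apply: integral0_eq => x /= x0.
  by rewrite lt0_exponential_pdf.
- move=> n; have mg : measurable_fun setT (EFin \o g).
    by apply/measurable_EFinP; exact: measurable_exponential_pdf.
  rewrite (ge0_integral_density (mu := lebesgue_measure) (g := EFin \o g)) //.
  + rewrite -exponential_half_moment [RHS]integral_mkcond.
    apply: eq_integral => x _; rewrite patchE /= gE indicE -EFinM.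
    case: ifPn => [|_]; last by rewrite !mulr0.
    by rewrite inE /= in_itv /= andbT mulr1 => x0; rewrite ger0_norm.
  + by move=> x; rewrite lee_fin exponential_pdf_ge0 // ltW.
  + by move=> A mA; exact: (congr1 (fun f : set _ -> \bar R => f A) muE).
  + by apply/measurable_EFinP; apply: measurable_funX.
Qed.

End exponential_moments.

(** * The measure and its absolute moments in the cases t = 0, t = 1, t > 1 and 0 < t < 1 *)

Lemma muB_probability (R : realType) (t : R) : 0 <= t ->
  exists mu : probability (measurableTypeR R) R,
    [/\ forall A, mu A = muB t A,
        mu [set x | x < 0] = 0%E &
        forall n, (\int[mu]_x (`|x| ^+ n)%:E = (PB n t)%:E)%E].
Proof.
move=> t_ge0; have [->|t_neq0] := eqVneq t 0.
  exists (dirac (1 : measurableTypeR R)); split => [A||n].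
  - by rewrite /muB eqxx.
  - rewrite -[LHS]/(\d_(1%R : R) [set x : R | (x < 0)%R] : \bar R)%E.
    by rewrite diracE memNset //= ltNge ler01.
  - rewrite integral_dirac //.
      by rewrite diracT mul1e normr1 expr1n PB0.
    by apply/measurable_EFinP; apply: measurable_funX.
have t_gt0 : 0 < t by rewrite lt_neqAle eq_sym t_neq0.
have [t_lt1|t_gt1|->] := ltgtP t 1; last first.
- have [mu [muE mu0 mom]] := exponential_probability R.
  by exists mu; split => // n; rewrite mom PB1.
- have s_ge0 : 0 <= t^-1 by rewrite invr_ge0.
  have s_lt1 : t^-1 < 1 by rewrite invf_lt1.
  have w_ge0 k : 0 <= (t - 1) / t ^+ k.+1.
    by rewrite divr_ge0 ?exprn_ge0 // subr_ge0 ltW.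
  have p_ge0 k : 0 <= k.*2.+1%:R * (t - 1) by rewrite mulr_ge0 // subr_ge0 ltW.
  have [n||mu [muE mu0 mom]] := @discrete_probability R
    (fun k => (t - 1) / t ^+ k.+1) (fun k => k.*2.+1%:R * (t - 1))
    (fun n => PB n t) w_ge0 p_ge0; last 2 first.
  + by rewrite PB0n.
  + exists mu; split => // A; rewrite muE /muB (negPf t_neq0) ltNge ltW //=.
    by rewrite gt_eqF.
  have t1 : 1 - t^-1 != 0 by rewrite subr_eq0 gt_eqF.
  rewrite -PB_palindromic //.
  (* The n-th moment term is (t-1)^(n+1) t^(-1) times (2k+1)^n t^(-k), so the generating series is
     taken at 1/t < 1; the powers of t-1 and 1-1/t combine to t^n. *)
  have -> : t ^+ n * PB n t^-1 =
      (t - 1) ^+ n.+1 * t^-1 * (PB n t^-1 * (1 - t^-1) ^- n.+1).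
    have -> : t - 1 = t * (1 - t^-1) by rewrite mulrBr mulr1 divff.
    rewrite exprMn exprSr.
    by field; rewrite t_neq0 expf_neq0.
  rewrite (_ : series _ = (fun N => (t - 1) ^+ n.+1 * t^-1 *
      series (fun x => x.*2.+1%:R ^+ n * t^-1 ^+ x) N)).
    by apply: cvgM; [exact: cvg_cst | exact: cvg_PB_series].
  apply/funext => N; rewrite /series /= big_distrr /=; apply: eq_bigr => k _.
  by rewrite exprMn exprS exprVn exprS invfM; ring.
- have w_ge0 k : 0 <= (1 - t) * t ^+ k.
    by rewrite mulr_ge0 ?exprn_ge0 // subr_ge0 ltW.
  have p_ge0 k : 0 <= k.*2.+1%:R * (1 - t) by rewrite mulr_ge0 // subr_ge0 ltW.
  have [n||mu [muE mu0 mom]] := @discrete_probability R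
    (fun k => (1 - t) * t ^+ k) (fun k => k.*2.+1%:R * (1 - t))
    (fun n => PB n t) w_ge0 p_ge0; last 2 first.
  + by rewrite PB0n.
  + by exists mu; split => // A; rewrite muE /muB (negPf t_neq0) t_lt1.
  have t1 : 1 - t != 0 by rewrite subr_eq0 gt_eqF.
  (* One factor 1-t comes from the weight and n from the n-th power of the atom, which cancels the
     denominator of the generating series. *)
  have -> : PB n t = (1 - t) ^+ n.+1 * (PB n t * (1 - t) ^- n.+1).
    by rewrite mulrCA mulfV ?mulr1 // expf_neq0.
  rewrite (_ : series _ = (fun N => (1 - t) ^+ n.+1 *
      series (fun x => x.*2.+1%:R ^+ n * t ^+ x) N)).
    by apply: cvgM; [exact: cvg_cst | exact: cvg_PB_series].
  apply/funext => N; rewrite /series /= big_distrr /=; apply: eq_bigr => k _.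
  by rewrite exprMn exprS; ring.
Qed.

(** * Positive definiteness of moment sequences *)

Lemma finite_support_nat (V : nmodType) (c : nat -> V) :
  finite_set [set i | c i != 0] -> exists N, forall i, (N <= i)%N -> c i = 0.
Proof.
move=> /finite_seqP[s sE]; exists (\max_(i <- s) i).+1 => i Ni.
apply/eqP; apply: contraTT Ni => ci; rewrite -ltnNge ltnS.
have : [set i | c i != 0] i by [].
by rewrite sE /= => si; exact: leq_bigmax_seq.
Qed.

Lemma fsbig_nat_support (V : nmodType) (f : nat -> V) N :
  (forall i, (N <= i)%N -> f i = 0) ->
  \sum_(i \in [set: nat]) f i = \sum_(i < N) f i.
Proof.
move=> f0; rewrite fsbig_ord; apply/esym/fsbig_widen => // i [_ /= /negP].
by rewrite -leqNgt => /f0.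
Qed.

Lemma integrable_expr (R : realType) (mu : probability (measurableTypeR R) R) n :
  (\int[mu]_x (`|x| ^+ n)%:E < +oo)%E ->
  mu.-integrable setT (fun x : measurableTypeR R => (x ^+ n)%:E).
Proof.
move=> h; apply/integrableP; split.
  by apply/measurable_EFinP; exact: exprn_measurable.
by under eq_integral => x _ do rewrite /= normrX.
Qed.

Lemma integral_expr_nonneg (R : realType) (mu : probability (measurableTypeR R) R) n :
  mu [set x | x < 0] = 0%E ->
  (\int[mu]_x (x ^+ n)%:E = \int[mu]_x (`|x| ^+ n)%:E)%E.
Proof.
move=> mu0; apply: ae_eq_integral => //.
- by apply/measurable_EFinP; exact: exprn_measurable.
- by apply/measurable_EFinP; apply: measurable_funX.
exists [set x | x < 0]; split => //.
  rewrite -[X in measurable X]set_itvNyo; exact: measurable_itv.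
move=> x /=; apply: contra_notP => /negP; rewrite -leNgt => x0 _.
by rewrite ger0_norm.
Qed.

Lemma posdef_moments (R : realType) (mu : probability (measurableTypeR R) R)
    (a : nat -> R) :
  (forall n, mu.-integrable setT (fun x : measurableTypeR R => (x ^+ n)%:E)) ->
  (forall n, \int[mu]_x (x ^+ n)%:E = (a n)%:E)%E ->
  posdef_seq a.
Proof.
move=> int_x mom c /finite_support_nat[N c0].
(* Since [c] vanishes from N on, both sums reduce to indices below N. *)
rewrite (fsbig_nat_support (N := N)) => [|i /c0 ci]; last first.
  by apply: fsbig1 => j _; rewrite ci mulr0 mul0r.
rewrite (_ : \sum_(i < N) _ = \sum_(i < N) \sum_(j < N) a (i + j)%N * c i * c j);
  last first.
  apply: eq_bigr => i _; apply: fsbig_nat_support => j /c0 ->.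
  by rewrite mulr0.
rewrite -lee_fin.
have -> : (\sum_(i < N) \sum_(j < N) a (i + j)%N * c i * c j)%:E =
    (\int[mu]_x (\sum_(i < N) \sum_(j < N) (c i * c j)%:E * (x ^+ (i + j))%:E))%E.
  rewrite integral_sum // => [|i]; last first.
    by apply: integrable_sum => // j _; exact: integrableZl.
  rewrite -sumEFin; apply: eq_bigr => i _.
  rewrite integral_sum // => [|j]; last exact: integrableZl.
  rewrite -sumEFin; apply: eq_bigr => j _.
  by rewrite integralZl // mom -EFinM; congr EFin; ring.
apply: integral_ge0 => x _.
(* The integrand is the square of the polynomial with coefficients [c]. *)
rewrite (_ : (\sum_(i < N) _)%E = ((\sum_(i < N) c i * x ^+ i) ^+ 2)%:E).
  by rewrite lee_fin sqr_ge0.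
rewrite expr2 big_distrl /= -sumEFin; apply: eq_bigr => i _.
rewrite big_distrr /= -sumEFin; apply: eq_bigr => j _.
by rewrite -EFinM exprD; congr EFin; ring.
Qed.

Theorem theorem3p1 (R : realType) (t : R) (t_ge0 : 0 <= t) :
  (exists mu : probability (measurableTypeR R) R,
      (forall A : set R, measurable (A : set (measurableTypeR R)) ->
         mu A = muB t A) /\
      (forall n : nat,
         (\int[mu]_x (x ^+ n)%:E = (PB n t)%:E)%E)) /\
  posdef_seq (fun n : nat => PB n t).
Proof.
have [mu [muE mu0 abs_mom]] := muB_probability t_ge0.
have mom n : (\int[mu]_x (x ^+ n)%:E = (PB n t)%:E)%E.
  by rewrite integral_expr_nonneg.
split; first by exists mu; split => // A _; exact: muE.
apply: (posdef_moments (mu := mu)) => // n.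
(* The absolute moments equal [PB n t], hence are finite, and every power of x is integrable. *)
by apply: integrable_expr; rewrite abs_mom ltry.
Qed.
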